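(* Let $\mathcal{F}(r)$ be a positive, continuous function on a finite interval $[r_{\min},r_{\max}]\subset(0,\infty)$ (and zero elsewhere), and let each droplet of initial radius $r$ follow the trajectory $z_t=z_t(r)$ described in the context (gravity, Stokes drag, and the $D$-squared law of evaporation with evaporation constant $K>0$), with duration $\zeta=\zeta(r)$. Then for every $z>0$, $$\int_0^\infty 1_{(0,z]}(z_t)\,dt\le\zeta\le \frac{r^2}{K},$$ hence $$m(z)\le\frac1K\int_{r_{\min}}^{r_{\max}}r^2\,\mathcal{F}(r)\,dr,$$ which shows that $m(z)$ is bounded.
   Context: Let $\rho,\mu,g,v,w,K>0$ be constants ($\rho$ mass density of sea water, $\mu$ dynamic viscosity of the atmosphere, $g$ gravity, $v$ initial velocity, $w$ vertical wind speed, $K$ evaporation constant). For a droplet of initial radius $r$, the radius at time $t$ is given by $r_t^2=r^2-Kt$ for $0\le t\le r^2/K$, and the trajectory $z_t=z_t(r)$ solves, on $0\le t<r^2/K$, $$z_t''=-g+\frac{1}{\tau_t}(w-z_t'),\qquad z_0=0,\quad z_0'=v,\qquad \tau_t=\frac{2\rho(r^2-Kt)}{9\mu}.$$ The duration $\zeta=\zeta(r)$ of the droplet's flight is the smallest root of $z_t=0$ in $(0,r^2/K)$ if there is one (the droplet returns to the ocean surface), and $\zeta=r^2/K$ otherwise (the droplet evaporates in flight). After its duration the droplet makes no contribution: $z_t$ and $r_t$ are set equal to $0$ for $t\ge\zeta$. The mean function $m(z)$ is the mean of the total mass of airborne droplets at height at most $z$ and is defined by $$m(z)=\tfrac43\pi\rho\int_0^\infty\int_0^\infty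 r_s^3\,1_{(0,z]}(z_s(r))\,\mathcal{F}(r)\,dr\,ds,\qquad z>0,$$ where $1_{(0,z]}$ is the indicator function of $(0,z]$ and $r_s$ depends on the initial radius $r$.
   Formalization: The printed bound on m(z) is false (scaling ρ and μ together scales only m), so the bound proved has the missing factor (4/3)πρr³ inside the integral; the printed bound is proved only when (4/3)πρ r_max³ ≤ 1. Boundedness of m is proved in full. *)

(* Defs.v *)
From HB Require Import structures.
From mathcomp Require Import all_boot all_order all_algebra.
From mathcomp Require Import all_classical all_reals all_analysis.

Set Implicit Arguments.
Unset Strict Implicit.
Unset Printing Implicit Defensive.

Import Order.TTheory GRing.Theory Num.Theory.
Import numFieldNormedType.Exports.

Local Open Scope classical_set_scope.
Local Open Scope ring_scope.

(* MathComp-Analysis, over an arbitrary [R : realType].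

   [rho] is the mass density of sea water, [mu] the dynamic viscosity of the
   atmosphere, [g] gravity, [v] the initial velocity, [w] the vertical wind
   speed, [K] the evaporation constant and [r] the initial radius. *)

(* Derivative of [f] at [t] relative to [D]: two-sided at interior points of
   [D], one-sided at an endpoint. *)
Definition deriv_within (R : realType) (D : set R) (f : R -> R) (t l : R) : Prop :=
  (fun s => (f s - f t) / (s - t)) @ within D t^' --> l.

Definition evaporation_time (R : realType) (K r : R) : R := r ^+ 2 / K.

Definition response_time (R : realType) (rho mu K r t : R) : R :=
  2 * rho * (r ^+ 2 - K * t) / (9 * mu).

(* [y] solves y'' = - g + (w - y') / tau, y(0) = 0, y'(0) = v on
   [0, r^2 / K[; the witness [u] is y'.  Values of [y] outside this interval
   are unconstrained, and none of the definitions below looks at them. *)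
Definition trajectory (R : realType) (rho mu g v w K r : R) (y : R -> R) : Prop :=
  let D := `[0, evaporation_time K r[%classic in
  exists u : R -> R,
    [/\ y 0 = 0, u 0 = v &
        forall t, D t ->
          deriv_within D y t (u t) /\
          deriv_within D u t (- g + (w - u t) / response_time rho mu K r t)].

Definition flight_roots (R : realType) (K r : R) (y : R -> R) : set R :=
  [set t | 0 < t < evaporation_time K r /\ y t = 0].

(* [xget x0 A] is an element of [A] if there is one, and [x0] otherwise; the
   set used here has at most one element. *)
Definition duration (R : realType) (K r : R) (y : R -> R) : R :=
  xget (evaporation_time K r)
    [set t | flight_roots K r y t /\ lbound (flight_roots K r y) t].

Definition height (R : realType) (K r : R) (y : R -> R) (t : R) : R :=
  if t < duration K r y then y t else 0.

Definition radius (R : realType) (K r : R) (y : R -> R) (t : R) : R :=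
  if t < duration K r y then Num.sqrt (r ^+ 2 - K * t) else 0.

Definition droplet_mass (R : realType) (rho r : R) : R :=
  4 / 3 * pi * rho * r ^+ 3.

(* [y r] is the trajectory of a droplet of initial radius [r]. *)
Definition mean_mass (R : realType) (rho K : R) (y : R -> R -> R) (F : R -> R)
    (z : R) : \bar R :=
  ((4 / 3 * pi * rho)%:E *
   \int[lebesgue_measure]_(s in `[0%R, +oo[)
     \int[lebesgue_measure]_(r in `[0%R, +oo[)
       (radius K r (y r) s ^+ 3 * \1_(`]0%R, z]) (height K r (y r) s) * F r)%:E)%E.

(* Main.v *)
Require Import Defs.
From HB Require Import structures.
From mathcomp Require Import all_boot all_order all_algebra.
From mathcomp Require Import all_classical all_reals all_analysis.
From mathcomp Require Import measurable_realfun ring.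
Import Order.TTheory GRing.Theory Num.Theory.
Import numFieldNormedType.Exports.
Local Open Scope classical_set_scope.
Local Open Scope ring_scope.

(** Almost nothing about the dynamics is needed: a droplet contributes to the
    integral defining [m] at time [s] only if [s < zeta(r) <= r^2 / K], and its
    mass is then at most its initial mass.  So the integrand is dominated by the
    initial mass times the indicator of [0 <= s < r^2 / K], and exchanging the
    integrals produces the factor [r^2 / K]. *)

(* Without measurability the integral of a nonnegative function is a lower
   integral.  This spares us the measurability of [(s, r) |-> height K r (y r) s],
   for which the dependence of [y r] on [r] would have to be controlled. *)
Lemma ge0_le_integral_lower d (T : measurableType d) (R : realType)
    (mu : {measure set T -> \bar R}) (D : set T) (f g : T -> \bar R) :
  (forall x, D x -> (0 <= f x)%E) -> (forall x, D x -> (f x <= g x)%E) ->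
  (\int[mu]_(x in D) f x <= \int[mu]_(x in D) g x)%E.
Proof.
move=> f0 fg; have g0 x : D x -> (0 <= g x)%E.
  by move=> Dx; exact: le_trans (f0 _ Dx) (fg _ Dx).
rewrite !ge0_integralE//; apply: ge_ereal_sup => _ [h /= hf <-].
apply: ereal_sup_ubound; exists h => //= x.
apply: le_trans (hf x) _; rewrite !patchE; case: ifPn => // /set_mem; exact: fg.
Qed.

Lemma lebesgue_measure_itv0 (R : realType) (a : R) : 0 <= a ->
  lebesgue_measure (`[0, a[%classic : set R) = a%:E.
Proof.
move=> a0; rewrite lebesgue_measure_itv /= lte_fin; case: ifPn => [_|].
  by rewrite -EFinD subr0.
by rewrite -leNgt => a_le0; congr EFin; apply/le_anti/andP.
Qed.

Section droplet.
Context {R : realType}.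
Implicit Types (K r s z rho : R) (y : R -> R).

Lemma duration_ge0 K r y : 0 <= K -> 0 <= duration K r y.
Proof.
move=> K0; rewrite /duration; case: xgetP => [t _ [[/andP[/ltW]]]//|_].
by rewrite divr_ge0// sqr_ge0.
Qed.

(** In [duration], either the least root is chosen, which lies before the evaporation time, or the
    default value, which is that time itself. *)
Lemma duration_le K r y : duration K r y <= r ^+ 2 / K.
Proof. by rewrite /duration; case: xgetP => [t _ [[/andP[_ /ltW]]]|]. Qed.

(** From [duration] on, [height] is reset to 0, and the interval is open at 0, so a landed or
    evaporated droplet is never counted. *)
Lemma height_in_lt_duration K r y z t :
  height K r y t \in `]0, z]%classic -> t < duration K r y.
Proof.
by rewrite inE /= in_itv /= /height; case: ifP => // _; rewrite ltxx.
Qed.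

Lemma time_aloft_le K r y z : 0 <= K ->
  (\int[lebesgue_measure]_(t in `[0%R, +oo[)
      (\1_(`]0%R, z]) (height K r y t))%:E <= (duration K r y)%:E)%E.
Proof.
move=> K0; have d0 := duration_ge0 K r y K0.
(* The indicator of being aloft is dominated by that of [[0, duration[], whose integral is the
   length of this interval. *)
apply: (@le_trans _ _ (\int[lebesgue_measure]_(t in `[0%R, +oo[)
  (\1_(`[0%R, duration K r y[) t)%:E)%E).
  apply: ge0_le_integral_lower => t; rewrite /= in_itv /= andbT => t0.
    by rewrite lee_fin.
  rewrite lee_fin !indicE; case: (boolP (height _ _ _ _ \in _)) => [|_].
    by move=> /height_in_lt_duration => td; rewrite mem_set//= in_itv /= t0.
  by rewrite ler0n.
rewrite integral_indic// setIidl; last first.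
  by move=> t /=; rewrite !in_itv /= => /andP[->].
by rewrite /= lebesgue_measure_itv0.
Qed.

Lemma radius_ge0 K r y s : 0 <= Defs.radius K r y s.
Proof. by rewrite /Defs.radius; case: ifP => // _; exact: sqrtr_ge0. Qed.

Lemma radius_le K r y s : 0 <= K -> 0 <= r -> 0 <= s -> Defs.radius K r y s <= r.
Proof.
move=> K0 r0 s0; rewrite /Defs.radius; case: ifP => // _.
by rewrite -[leRHS](ger0_norm r0) -sqrtr_sqr ler_wsqrtr// gerBl mulr_ge0.
Qed.

(** Tonelli's theorem is applied to a function supported on this region of pairs (time, radius), so
    the region has to be jointly measurable. *)
Lemma measurable_before_evaporation K :
  measurable [set p : R * R | 0 <= p.1 < p.2 ^+ 2 / K].
Proof.
rewrite [X in measurable X](_ : _ =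
    (fun p : R * R => p.1) @^-1` `[0, +oo[ `&`
    (fun p : R * R => p.2 ^+ 2 / K - p.1) @^-1` `]0, +oo[); last first.
  by apply/seteqP; split=> p /=; rewrite !in_itv /= !andbT subr_gt0 => /andP.
apply: measurableI; rewrite -[X in measurable X]setTI.
  exact: measurable_fst.
have : measurable_fun setT (fun p : R * R => p.2 ^+ 2 / K - p.1).
  apply: measurable_funB => //; apply: measurable_funM => //.
  exact: measurable_funX.
by apply.
Qed.

Lemma mean_mass_le rho K (y : R -> R -> R) (F : R -> R) z :
  0 <= rho -> 0 < K -> measurable_fun setT F -> (forall r, 0 <= F r) ->
  (mean_mass rho K y F z <=
   K^-1%:E * \int[lebesgue_measure]_(r in `[0%R, +oo[)
               (droplet_mass rho r * (r ^+ 2 * F r))%:E)%E.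
Proof.
move=> rho0 K0 mF F0; pose P : set R := `[0, +oo[%classic.
have PE r : P r = (0 <= r) :> Prop by rewrite /P /= in_itv /= andbT.
(* Extension by zero off the half-line turns all integrals into integrals over [R], where Tonelli's
   theorem is applied. *)
pose f : R -> \bar R := (fun r => (r ^+ 3 * F r)%:E) \_ P.
have f0 r : (0 <= f r)%E.
  apply: erestrict_ge0 => {}r; rewrite PE => r0.
  by rewrite lee_fin mulr_ge0// exprn_ge0.
have mP : measurable P by exact: measurable_itv.
have mf : measurable_fun setT f.
  apply/(measurable_restrictT _ mP)/measurable_funTS/measurable_EFinP.
  by apply: measurable_funM => //; exact: exprn_measurable.
pose A : set (R * R) := [set p : R * R | 0 <= p.1 < p.2 ^+ 2 / K].
(* The dominating function, up to the constant [4 / 3 * pi * rho]: the droplet keeps its initial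
   radius until the evaporation time. *)
pose h (p : R * R) : \bar R := ((\1_A p)%:E * f p.2)%E.
have h0 p : (0 <= h p)%E by rewrite mule_ge0// lee_fin.
have mh : measurable_fun setT h.
  apply: emeasurable_funM; last exact: measurableT_comp.
  apply/measurable_EFinP; apply: measurable_indic.
  exact: measurable_before_evaporation.
have c0 : 0 <= 4 / 3 * pi * rho by rewrite !mulr_ge0// pi_ge0.
have dom : (\int[lebesgue_measure]_(s in P) \int[lebesgue_measure]_(r in P)
    (Defs.radius K r (y r) s ^+ 3 * \1_(`]0%R, z]) (height K r (y r) s) * F r)%:E <=
    \int[lebesgue_measure]_s \int[lebesgue_measure]_r h (s, r))%E.
  have i0 s r : (0 <= (Defs.radius K r (y r) s ^+ 3 *
      \1_(`]0%R, z]) (height K r (y r) s) * F r)%:E)%E.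
    by rewrite lee_fin !(exprn_ge0, mulr_ge0)// radius_ge0.
  rewrite integral_mkcond; apply: ge0_le_integral_lower => s _.
    by apply: erestrict_ge0 => {}s _; apply: integral_ge0 => r _.
  rewrite patchE; case: ifPn => [/set_mem|_]; last exact: integral_ge0.
  rewrite PE => s0; rewrite integral_mkcond.
  apply: ge0_le_integral_lower => r _; first exact: erestrict_ge0.
  rewrite patchE; case: ifPn => [rP|_]; last exact: h0.
  move: (rP) => /set_mem; rewrite PE => r0.
  rewrite /h /f patchE /= rP -EFinM lee_fin [leRHS]mulrA.
  rewrite ler_wpM2r// !indicE [leRHS]mulrC.
  (* Off the height range the left side is 0. Within it, [s < duration <= r ^+ 2 / K] puts [(s, r)]
     in [A], and [radius_le] compares the cubes. *)
  case: (boolP (height _ _ _ _ \in _)) => [|_]; last first.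
    by rewrite mulr0 mulr_ge0// exprn_ge0.
  move=> /height_in_lt_duration => sd; rewrite mem_set; last first.
    by rewrite /A /= s0 (lt_le_trans sd)// duration_le.
  by rewrite !mulr1 lerXn2r ?nnegrE ?radius_ge0// radius_le// ltW.
have inner r : (\int[lebesgue_measure]_s h (s, r) =
    (r ^+ 2 / K)%:E * f r)%E.
  (* The section of [A] at fixed [r] is an interval of length [r ^+ 2 / K]. *)
  have hE s : h (s, r) = ((\1_(`[0, r ^+ 2 / K[) s)%:E * f r)%E.
    rewrite /h !indicE.
    suff -> : ((s, r) \in A) = (s \in `[0, r ^+ 2 / K[%classic) by [].
    by apply/idP/idP => /set_mem sr; apply: mem_set; move: sr;
      rewrite /A /= in_itv.
  under eq_integral do rewrite hE.
  rewrite ge0_integralZr//; last exact/measurable_EFinP/measurable_indic.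
  rewrite integral_indic// setIT /= lebesgue_measure_itv0//.
  by rewrite divr_ge0 ?sqr_ge0 ?ltW.
apply: le_trans (lee_wpmul2l _ dom) _; first by rewrite lee_fin.
rewrite (fubini_tonelli (m1 := lebesgue_measure)
  (m2 := lebesgue_measure) _ mh h0).
under eq_integral do rewrite inner.
have m5 : measurable_fun setT (fun r => (r ^+ 2 / K)%:E * f r)%E.
  apply: emeasurable_funM => //; apply/measurable_EFinP.
  by apply: measurable_funM => //; exact: exprn_measurable.
rewrite -ge0_integralZl_EFin//; last first.
  by move=> r _; rewrite mule_ge0// lee_fin divr_ge0 ?sqr_ge0 ?ltW.
rewrite -ge0_integralZl_EFin ?invr_ge0 ?(ltW K0)//; last 2 first.
- move=> r /=; rewrite in_itv /= andbT => r0; rewrite lee_fin.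
  by rewrite !mulr_ge0 ?pi_ge0 ?sqr_ge0 ?exprn_ge0.
- apply/measurable_funTS/measurable_EFinP; rewrite /droplet_mass.
  do 2!(apply: measurable_funM => //; try exact: exprn_measurable).
(* From here on the two sides are equal: the constant times [r ^+ 3] is [droplet_mass rho r]. *)
rewrite [leRHS]integral_mkcond le_eqVlt; apply/orP; left; apply/eqP.
apply: eq_integral => r _; rewrite /f !patchE; case: ifPn => _.
  by rewrite -!EFinM /droplet_mass; congr EFin; ring.
by rewrite !mule0.
Qed.

End droplet.

Theorem mainTheorem4 (R : realType) (rho mu g v w K : R)
    (rho_gt0 : 0 < rho) (mu_gt0 : 0 < mu) (g_gt0 : 0 < g)
    (v_gt0 : 0 < v) (w_gt0 : 0 < w) (K_gt0 : 0 < K)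
    (rmin rmax : R) (rmin_gt0 : 0 < rmin) (rmin_le_rmax : rmin <= rmax)
    (F : R -> R)
    (F_gt0 : forall r, r \in `[rmin, rmax] -> 0 < F r)
    (F_cont : {within `[rmin, rmax], continuous F})
    (F_eq0 : forall r, r \notin `[rmin, rmax] -> F r = 0)
    (y : R -> R -> R)
    (y_traj : forall r, 0 < r -> trajectory rho mu g v w K r (y r)) :
  [/\ (forall r z, 0 < r -> 0 < z ->
         (\int[lebesgue_measure]_(t in `[0%R, +oo[)
            (\1_(`]0%R, z]) (height K r (y r) t))%:E
          <= (duration K r (y r))%:E)%E
         /\ duration K r (y r) <= r ^+ 2 / K),
      (forall z, 0 < z ->
         (mean_mass rho K y F z <=
          K^-1%:E * \int[lebesgue_measure]_(r in `[rmin, rmax])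
                      (droplet_mass rho r * (r ^+ 2 * F r))%:E)%E),
      (droplet_mass rho rmax <= 1 ->
       forall z, 0 < z ->
         (mean_mass rho K y F z <=
          K^-1%:E * \int[lebesgue_measure]_(r in `[rmin, rmax])
                      (r ^+ 2 * F r)%:E)%E) &
      (exists C : R, forall z, 0 < z -> (mean_mass rho K y F z <= C%:E)%E)].
Proof.
pose D : set R := `[rmin, rmax]%classic.
have mD : measurable D by exact: measurable_itv.
have F_ge0 r : 0 <= F r.
  by case: (boolP (r \in `[rmin, rmax])) => [/F_gt0/ltW|/F_eq0 ->].
(* This form of [F_eq0] transfers measurability from [D], where [F] is continuous, to the whole
   line. *)
have FD : F = F \_ D.
  apply/funext => r; rewrite patchE; case: ifPn => // /negP rD.
  by apply: F_eq0; apply/negP => rI; apply: rD; rewrite inE.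
have mF : measurable_fun setT F.
  rewrite FD; apply/(measurable_restrictT _ mD).
  exact: subspace_continuous_measurable_fun.
have bound z : (mean_mass rho K y F z <=
    K^-1%:E * \int[lebesgue_measure]_(r in D)
                (droplet_mass rho r * (r ^+ 2 * F r))%:E)%E.
  apply: le_trans (mean_mass_le rho K y F z (ltW rho_gt0) K_gt0 mF F_ge0) _.
  rewrite lee_wpmul2l ?lee_fin ?invr_ge0 ?(ltW K_gt0)//.
  (* The integrals over the half-line and over [D] agree, since [F] vanishes off [D] and [0 < rmin]
     places [D] in the half-line. *)
  rewrite integral_mkcond [leRHS]integral_mkcond le_eqVlt; apply/orP; left.
  apply/eqP/eq_integral => r _; rewrite !patchE.
  case: (boolP (r \in D)) => [rD|rD].
    rewrite mem_set//= in_itv /= andbT.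
    move: rD; rewrite inE /D /= in_itv /= => /andP[+ _].
    by apply: le_trans; exact: ltW.
  by rewrite FD patchE (negbTE rD) !mulr0; case: ifP.
split=> //.
- by move=> r z _ _; split; [apply: time_aloft_le; exact: ltW|exact: duration_le].
(* The mass of a droplet increases with its radius, so the assumption at [rmax] makes the factor
   [droplet_mass rho r] at most 1 on all of [D]. *)
- move=> m1 z _; apply: le_trans (bound z) _.
  rewrite lee_wpmul2l ?lee_fin ?invr_ge0 ?(ltW K_gt0)//.
  have r_gt0 r : D r -> 0 < r.
    by rewrite /D /= in_itv /= => /andP[+ _]; exact: lt_le_trans.
  have c_ge0 : 0 <= 4 / 3 * pi * rho by rewrite !mulr_ge0 ?pi_ge0// ltW.
  apply: ge0_le_integral_lower => r Dr; have r_ge0 := ltW (r_gt0 _ Dr).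
    rewrite lee_fin; apply: mulr_ge0; apply: mulr_ge0 => //; last exact: sqr_ge0.
    exact: exprn_ge0.
  rewrite lee_fin ler_piMl ?mulr_ge0 ?sqr_ge0//; apply: le_trans m1.
  rewrite ler_wpM2l// lerXn2r ?nnegrE//.
    exact: le_trans (ltW rmin_gt0) rmin_le_rmax.
  by move: Dr; rewrite /D /= in_itv /= => /andP[].
(* The bound does not involve [z], and it is finite because its integrand is continuous on the
   compact interval [D]. *)
- set I := (\int[_]_(_ in _) _)%E in bound.
  have I_fin : I \is a fin_num.
    apply: integrable_fin_num => //.
    apply: (@continuous_compact_integrable _
      (fun r => droplet_mass rho r * (r ^+ 2 * F r)) D).
      exact: segment_compact.
    move=> r; rewrite /droplet_mass.
    have cX n : {for r, continuous ((fun x => x ^+ n) : subspace D -> R)}.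
      by apply: continuous_subspaceT; exact: exprn_continuous.
    apply: cvgM; first by apply: cvgM; [exact: cvg_cst|exact: cX].
    by apply: cvgM; [exact: cX|exact: F_cont].
  exists (K^-1 * fine I) => z _.
  by rewrite EFinM fineK.
Qed.
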